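(* There is no $(6,2;+1)$-digraph; that is, there is no $2$-geodetic digraph with minimum out-degree $6$ and order $1+6+6^2+1=44$.
   Context: Digraphs are finite and without multiple arcs. A digraph $G$ is $k$-geodetic if for any (not necessarily distinct) vertices $u,v$ there is at most one directed walk from $u$ to $v$ of length at most $k$ (walks of length $0$ count, so there are no directed cycles of length at most $k$). A $(d,k;+1)$-digraph is a $k$-geodetic digraph with minimum out-degree $d$ and order $M(d,k)+1$, where $M(d,k)=1+d+d^2+\dots+d^k$. It is known that every $(d,k;+1)$-digraph with $d,k\ge 2$ is diregular (all in-degrees and out-degrees equal $d$). *)

(* Defs.v *)
From mathcomp Require Import all_boot.
Set Implicit Arguments.
Unset Strict Implicit.
Unset Printing Implicit Defensive.

(* A finite digraph without multiple arcs is a relation e on a finType V, with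
   an arc from u to v when e u v; loops are not excluded a priori. *)

Definition out_degree (V : finType) (e : rel V) (v : V) : nat :=
  #|[set w | e v w]|.

Definition has_min_out_degree (V : finType) (e : rel V) (d : nat) : Prop :=
  (forall v : V, d <= out_degree e v) /\ (exists v : V, out_degree e v = d).

(* A walk from u to v is given by the list p of its vertices after u, so its
   length is size p, and p = [::] is the walk of length 0 from u to u. *)
Definition is_walk (V : finType) (e : rel V) (u v : V) (p : seq V) : Prop :=
  path e u p /\ last u p = v.

Definition geodetic (V : finType) (e : rel V) (k : nat) : Prop :=
  forall (u v : V) (p q : seq V),
    is_walk e u v p -> size p <= k ->
    is_walk e u v q -> size q <= k -> p = q.

Definition moore_bound (d k : nat) : nat := \sum_(i < k.+1) d ^ i.

Definition excess_one_digraph (d k : nat) (V : finType) (e : rel V) : Prop :=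
  [/\ geodetic e k, has_min_out_degree e d & #|V| = moore_bound d k + 1].

(* Main.v *)
Require Import Defs.
From mathcomp Require Import all_boot all_order all_algebra all_field.
From mathcomp Require Import ring zify.
Set Implicit Arguments.
Unset Strict Implicit.
Unset Printing Implicit Defensive.
Import Order.TTheory GRing.Theory Num.Theory.

(* Counting shows that such a digraph is out-regular of degree 6 and that every
   vertex u misses exactly one vertex o u, its outlier, within two steps, so
   that I + A + A^2 = J - P for the adjacency matrix A and the matrix P of o.

   If the in-degrees were not constant, the image of o would consist of two
   vertices with the same out-neighbours; identifying them would give a digraph
   with I + A + A^2 = J, which the trace of A excludes.  Hence o is an
   automorphism.

   On an eigenspace of P for the eigenvalue z the matrix A has only the roots
   of x^2 + x + 1 + z as eigenvalues, so the numbers of arcs u -> o^j u, which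
   are the traces of A times powers of P^-1, are controlled by eigenvalue
   multiplicities.  For z = 1 the two roots are conjugate and equally frequent.

   The points fixed by a power of o induce a digraph of the same kind with a
   smaller degree.  By induction on the degree d, for 2 <= d <= 6, such a proper
   induced digraph has 2 or 4 points, so all cycles of o have the same length m
   up to a single cycle of length 2 or 4.  The case z = 1 then leaves (d, m) =
   (3, 2), (6, 4) without and (3, 6) with an exceptional 2-cycle; these fall to
   z = -1, to z = i and to a direct argument. *)

(** * Traces of idempotents and of matrices with a quadratic equation *)

Section MatrixTraces.
Local Open Scope ring_scope.

(** In a full-rank factorisation Q = C R, idempotency forces R C = 1, and the trace is cyclic. *)
Lemma mxtrace_idem (F : fieldType) n (Q : 'M[F]_n) :
  Q *m Q = Q -> \tr Q = (\rank Q)%:R.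
Proof.
move=> QQ; have QB := mulmx_base Q; rewrite -{1}QB mxtrace_mulC.
have := row_base_free Q; have := col_base_full Q.
move: (col_base Q) (row_base Q) QB => C R QB Cfull Rfree.
suff -> : R *m C = 1%:M by rewrite mxtrace1.
apply: (row_free_inj Rfree); rewrite mul1mx; apply: (row_full_inj Cfull).
by rewrite -[R *m C *m R]mulmxA mulmxA QB QQ.
Qed.

(** (A - a) E / (b - a) is idempotent: it projects onto the b-eigenspace of A inside the image of E,
    and q is its rank. *)
Lemma idem_trace_split (F : fieldType) n (A E : 'M[F]_n) (a b : F) :
    a != b -> E *m E = E -> A *m E = E *m A ->
    A *m A *m E - (a + b) *: (A *m E) + (a * b) *: E = 0 ->
  exists q : nat, \tr (A *m E) - a * \tr E = (b - a) * q%:R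
    /\ (q = 0%N -> A *m E = a *: E).
Proof.
move=> nab EE AE quad.
have nba : b - a != 0 by rewrite subr_eq0 eq_sym.
pose X := A *m E - a *: E.
have XX : X *m X = (b - a) *: X.
  have AEE : A *m E *m E = A *m E by rewrite -mulmxA EE.
  have AEA : A *m E *m (A *m E) = A *m A *m E.
    by rewrite mulmxA -(mulmxA A E A) -AE mulmxA -mulmxA EE.
  have EAE : E *m (A *m E) = A *m E by rewrite mulmxA -AE AEE.
  move/eqP: quad; rewrite addr_eq0 subr_eq => /eqP quad.
  rewrite /X mulmxBl !mulmxBr -!scalemxAl -!scalemxAr AEE AEA EAE EE quad.
  by apply/matrixP=> i j; rewrite !mxE; ring.
pose Q := (b - a)^-1 *: X.
have QQ : Q *m Q = Q.
  by rewrite /Q -scalemxAl -scalemxAr XX (scalerA (b - a)^-1 (b - a)) mulVf //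
    scale1r.
have XQ : X = (b - a) *: Q by rewrite /Q scalerA divff // scale1r.
exists (\rank Q); split.
  by rewrite -(mxtrace_idem QQ) -!mxtraceZ -XQ /X raddfB.
move/eqP; rewrite mxrank_eq0 => /eqP Q0.
by apply/eqP; rewrite -subr_eq0 -/X XQ Q0 scaler0.
Qed.

(* The roots of x^2 + x + c are -1/2 +- s with s purely imaginary, so real
   traces force them to occur equally often. *)
Lemma real_trace_split n (A E : 'M[algC]_n) (c : algC) :
    1 < 4 * c -> E *m E = E -> A *m E = E *m A ->
    A *m A *m E + A *m E + c *: E = 0 ->
    \tr E \is Num.real -> \tr (A *m E) \is Num.real ->
  exists q : nat, \tr E = 2 * q%:R /\ \tr (A *m E) = - q%:R.
Proof.
move=> c4 EE AE quad rE rAE.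
pose s := sqrtC (1 - 4 * c).
have s2 : s ^+ 2 = 1 - 4 * c by rewrite sqrtCK.
have s2lt0 : s ^+ 2 < 0 by rewrite s2 subr_lt0.
have s0 : s != 0 by apply: contraTneq s2lt0 => ->; rewrite expr0n ltxx.
pose a : algC := (-1 - s) / 2; pose b : algC := (-1 + s) / 2.
have ab1 : a + b = -1 by rewrite /a /b; field.
have ab2 : a * b = c.
  have -> : a * b = (1 - s ^+ 2) / 4 by rewrite /a /b; field.
  by rewrite s2; field.
have ba : b - a = s by rewrite /a /b; field.
have nab : a != b by rewrite eq_sym -subr_eq0 ba.
have [|q [trq _]] := idem_trace_split nab EE AE.
  by rewrite ab1 ab2 scaleN1r opprK.
pose x := \tr (A *m E) + \tr E / 2; pose y := q%:R - \tr E / 2 : algC.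
have xsy : x = s * y.
  by rewrite /x /y mulrBr -ba -trq /a /b; field.
have rx : x \is Num.real by rewrite realD // realM // realV realn.
have ry : y \is Num.real by rewrite realB ?realn // realM // realV realn.
(* Since x is real, s^2 y^2 = x^2 >= 0, whereas s^2 < 0; hence the real number y has y^2 <= 0. *)
have y0 : y = 0.
  apply/eqP; rewrite -sqrf_eq0 eq_le -[0 <= _]realEsqr ry andbT.
  by rewrite -(nmulr_rge0 _ s2lt0) -exprMn -xsy -realEsqr.
have trE : \tr E = 2 * q%:R.
  by move/eqP: y0; rewrite subr_eq0 => /eqP ->; field.
exists q; split=> //.
by move/eqP: xsy; rewrite y0 mulr0 addr_eq0 trE => /eqP ->; field.
Qed.

End MatrixTraces.

(** * Digraphs with outliers *)

Definition walks2 (V : finType) (e : rel V) (u v : V) : nat :=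
  (u == v) + e u v + \sum_w e u w * e w v.

(** The entrywise form of I + A + A^2 = J - P, with booleans read as 0 and 1. *)
Definition is_outlier (V : finType) (e : rel V) (o : V -> V) : Prop :=
  forall u v, walks2 e u v = (v != o u).

Definition outdeg (V : finType) (e : rel V) (u : V) : nat := \sum_v e u v.
Definition indeg (V : finType) (e : rel V) (v : V) : nat := \sum_u e u v.

Lemma sum_pred1_mul (V : finType) (x : V) (F : V -> nat) :
  \sum_v (v == x) * F v = F x.
Proof.
by rewrite (bigD1 x) //= eqxx mul1n big1 ?addn0 // => v /negPf ->.
Qed.

Lemma sum_walks2 (V : finType) (e : rel V) u :
  \sum_v walks2 e u v = 1 + outdeg e u + \sum_w e u w * outdeg e w.
Proof.
rewrite !big_split /= exchange_big /=; congr (_ + _ + _).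
  under eq_bigr do rewrite eq_sym -[nat_of_bool _]muln1.
  by rewrite sum_pred1_mul.
by apply: eq_bigr => w _; rewrite big_distrr.
Qed.

Section Outlier.
Variables (V : finType) (e : rel V) (o : V -> V).
Hypothesis eo : is_outlier e o.

Lemma walks2_le1 u v : walks2 e u v <= 1.
Proof. by rewrite eo leq_b1. Qed.

Lemma sum_walk2_gt0 u w v : e u w -> e w v -> 0 < \sum_w e u w * e w v.
Proof. by move=> uw wv; rewrite (bigD1 w) //= uw wv. Qed.

Lemma no_loop u : e u u = false.
Proof.
by have := walks2_le1 u u; rewrite /walks2 eqxx; case: (e u u).
Qed.

Lemma no_digon u v : e u v -> e v u = false.
Proof.
move=> uv; apply/negP=> vu; have := sum_walk2_gt0 uv vu.
by have := walks2_le1 u u; rewrite /walks2 eqxx; lia.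
Qed.

Lemma no_shortcut u w v : e u w -> e w v -> e u v = false.
Proof.
move=> uw wv; apply/negP=> uv; have := sum_walk2_gt0 uw wv.
by have := walks2_le1 u v; rewrite /walks2 uv; lia.
Qed.

Lemma mid_uniq u w w' v : e u w -> e w v -> e u w' -> e w' v -> w = w'.
Proof.
move=> uw wv uw' w'v; apply/eqP/idPn=> ww'.
have := walks2_le1 u v; rewrite /walks2 (bigD1 w) //= (bigD1 w') 1?eq_sym //=.
by rewrite uw wv uw' w'v; lia.
Qed.

Lemma outlier_neq u : o u != u.
Proof. by have := eo u u; rewrite /walks2 eqxx eq_sym; case: eqP. Qed.

Lemma outlier_nadj u : e u (o u) = false.
Proof. by have := eo u (o u); rewrite /walks2 eqxx; case: (e _ _) => //=; lia.
Qed.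

Lemma outlier_nmid u w : e u w -> e w (o u) = false.
Proof.
move=> uw; apply/negP=> /(sum_walk2_gt0 uw).
by have := eo u (o u); rewrite /walks2 eqxx /=; lia.
Qed.

Lemma reach2 u v : v != o u -> u != v -> ~~ e u v -> exists2 w, e u w & e w v.
Proof.
move=> vou uv euv; have := eo u v.
rewrite /walks2 vou (negPf uv) (negPf euv) add0n => sum1.
have /existsP[w /andP[uw wv]] : [exists w, e u w && e w v].
  apply: contraT; rewrite negb_exists => /forallP nw; move: sum1.
  by rewrite big1 // => w _; have := nw w; case: (e u w); case: (e w v).
by exists w.
Qed.

(* The walks of length 1, 2 or 3 from u to v, sorted by their first arc on one
   side and by their last arc on the other. *)
Lemma walk3_count u v :
  outdeg e u + e (o u) v = indeg e v + \sum_w e u w * (o w == v).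
Proof.
have L : \sum_w e u w * walks2 e w v + \sum_w e u w * (o w == v) = outdeg e u.
  rewrite -big_split /=; apply: eq_bigr => w _; rewrite eo eq_sym.
  by case: (o w == v); case: (e u w).
have R : \sum_w walks2 e u w * e w v + e (o u) v = indeg e v.
  rewrite -(sum_pred1_mul (o u) (fun w => nat_of_bool (e w v))) -big_split /=.
  by apply: eq_bigr => w _; rewrite eo; case: (w == o u); case: (e w v).
have LR : \sum_w e u w * walks2 e w v = \sum_w walks2 e u w * e w v.
  under eq_bigr do rewrite mulnDr mulnDr.
  under [RHS]eq_bigr do rewrite mulnDl mulnDl.
  rewrite !big_split /=; congr (_ + _ + _).
    under eq_bigr do rewrite mulnC; rewrite sum_pred1_mul.
    by under eq_bigr do rewrite eq_sym; rewrite sum_pred1_mul.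
  under eq_bigr do rewrite big_distrr; under [RHS]eq_bigr do rewrite big_distrl.
  rewrite exchange_big /=; apply: eq_bigr => w _; apply: eq_bigr => x _.
  by rewrite mulnA.
by rewrite -L -R LR addnAC.
Qed.

End Outlier.

Record outlier_aut (V : finType) (e : rel V) (o : V -> V) : Prop := OutlierAut {
  oaut_outlier : is_outlier e o;
  oaut_inj : injective o;
  oaut_arc : forall u v, e (o u) (o v) = e u v
}.

Section OutlierAut.
Variables (V : finType) (e : rel V) (o : V -> V).
Hypothesis sys : outlier_aut e o.
Let eo : is_outlier e o := oaut_outlier sys.

Lemma arc_iter j u v : e (iter j o u) (iter j o v) = e u v.
Proof. by elim: j => //= j; rewrite (oaut_arc sys). Qed.

Lemma iter_o_inj j : injective (iter j o).
Proof. by elim: j => //= j IH x y /(oaut_inj sys)/IH. Qed.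

(* An arc from u to [o^a u] and one to [o^b u] give two walks of length 2 from
   u to [o^(a+b) u]. *)
Lemma orbit_arc_uniq u a b :
  e u (iter a o u) -> e u (iter b o u) -> iter a o u = iter b o u.
Proof.
move=> ua ub; apply: (mid_uniq eo ua _ ub (v := iter (a + b) o u)).
  by rewrite iterD arc_iter.
by rewrite addnC iterD arc_iter.
Qed.

(** In [walk3_count] the only [w] with [o w = v] contributes [e u w = e (o u) v], so the correction
    terms cancel. As [u] and [v] are arbitrary, the digraph is diregular. *)
Lemma outdeg_indeg u v : outdeg e u = indeg e v.
Proof.
have [g gK Kg] := injF_bij (oaut_inj sys); have := walk3_count eo u v.
suff -> : \sum_w e u w * (o w == v) = e (o u) v by lia.
rewrite -(Kg v) (oaut_arc sys) -(sum_pred1_mul (g v) (fun w =>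
  nat_of_bool (e u w))).
by apply: eq_bigr => w _; rewrite (inj_eq (oaut_inj sys)) mulnC.
Qed.

Lemma card_outlier d : (forall u, outdeg e u = d) -> 0 < #|V| ->
  #|V| = d * d + d + 2.
Proof.
move=> reg /card_gt0P[u _].
have : \sum_v walks2 e u v + 1 = #|V|.
  rewrite -sum1_card (bigD1 (o u)) //= [in RHS](bigD1 (o u)) //= eo eqxx add0n
    addnC.
  by congr (_ + _); apply: eq_bigr => v vo; rewrite eo vo.
rewrite sum_walks2 reg; under eq_bigr do rewrite reg.
by rewrite -big_distrl /= -/(outdeg e u) reg; lia.
Qed.

Section Fix.
Variable j : nat.
Definition fixT : finType := {x in [pred x : V | iter j o x == x]}.
Definition fix_e : rel fixT := fun x y => e (val x) (val y).
Lemma fix_o_proof (x : fixT) : iter j o (o (val x)) == o (val x).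
Proof. by rewrite -iterSr /= (eqP (valP x)). Qed.
Definition fix_o (x : fixT) : fixT := exist _ (o (val x)) (fix_o_proof x).

(** The middle vertex of a walk of length 2 between fixed points of [o^j] is unique, hence fixed
    too, so no such walk is lost in the induced digraph. *)
Lemma fix_outlier_aut : outlier_aut fix_e fix_o.
Proof.
split=> [u v|u v /(congr1 val)/(oaut_inj sys)/val_inj //|u v];
  last exact: (oaut_arc sys).
rewrite -!val_eqE /= -(eo (val u) (val v)) /walks2 /fix_e -val_eqE /=.
congr (_ + _); rewrite -(big_sub [pred x | iter j o x == x] (fun w =>
  e (val u) w * e w (val v))).
rewrite [RHS](bigID (mem [pred x | iter j o x == x])) /= [X in _ = _ + X]big1
  ?addn0 //.
move=> w wj; case uw: (e _ w); case wv: (e w _) => //; case/eqP: wj.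
apply: (mid_uniq eo _ _ uw wv).
  by rewrite -{1}(eqP (valP u)) arc_iter.
by rewrite -(eqP (valP v)) arc_iter.
Qed.
End Fix.

End OutlierAut.

(** * Cycle structure of the outlier automorphism *)

Lemma iter_dvd_order (V : finType) (o : V -> V) (x : V) j :
  injective o -> (iter j o x == x) = (order o x %| j).
Proof.
move=> oinj; have per q y : iter (q * order o x) o x = y -> y = x.
  by elim: q y => [|q IH] y <- //=; rewrite mulSn iterD (IH _ erefl) iter_order.
rewrite {1}(divn_eq j (order o x)) addnC iterD (per _ _ erefl).
rewrite /dvdn; have lt := ltn_pmod j (order_gt0 o x).
apply/eqP/eqP=> [E|->//]; by rewrite -(findex_iter lt) E findex0.
Qed.

Section SmallDegree.
Variables (V : finType) (e : rel V) (o : V -> V).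
Hypothesis sys : outlier_aut e o.
Let eo : is_outlier e o := oaut_outlier sys.
Let oinj : injective o := oaut_inj sys.

Lemma order_outlier_neq1 x : order o x != 1.
Proof.
apply/eqP=> o1; have := iter_dvd_order x 1 oinj.
by rewrite o1 /= (negPf (outlier_neq eo x)).
Qed.

Lemma order_outdeg0 : (forall u, outdeg e u = 0) -> forall x, order o x = 2.
Proof.
move=> d0 x; have ne u v : e u v = false.
  by have := d0 u; rewrite /outdeg (bigD1 v) //=; case: (e u v).
have : order o x %| 2.
  rewrite -iter_dvd_order //=; apply/eqP; apply: contraTeq isT => oox.
  have := eo (o x) x; rewrite /walks2 ne (negPf (outlier_neq eo x)) big1 =>
    [|w _]; last by rewrite ne.
  by rewrite eq_sym oox.
have := order_outlier_neq1 x; move=> n1 /[dup]/dvdn_leq; move/(_ isT).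
by case: (order o x) n1 => [|[|[|]]].
Qed.

(** The digraph is a directed 4-cycle on which [o] maps each vertex to its predecessor. An arc not
    reversed by [o], or a 3-cycle of [o], would produce five distinct vertices. *)
Lemma order_outdeg1 : 0 < #|V| -> (forall u, outdeg e u = 1) -> forall x,
  order o x = 4.
Proof.
move=> V0 d1; have V4 : #|V| = 4 by rewrite (card_outlier sys d1).
have five (s : seq V) : uniq s -> size s = 5 -> False.
  by move=> us s5; have := max_card (mem s); rewrite (card_uniqP us) s5 V4.
have neqE (x y : V) : x != y -> ((x == y) = false) * ((y == x) = false).
  by rewrite (eq_sym y) => /negPf.
have oxx := outlier_neq eo.
have back x y : e x y -> o y = x.
  move=> xy; apply/eqP; apply: contraT => oyx.
  have xny : x != y by apply: contraTneq xy => <-; rewrite (no_loop eo).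
  have [|||w yw wx] := reach2 eo (u := y) (v := x).
  - by rewrite eq_sym.
  - by rewrite eq_sym.
  - by rewrite (no_digon eo xy).
  case: (five [:: x; y; w; o x; o y]) => //.
  have wnx : w != x by apply: contraTneq wx => ->; rewrite (no_loop eo).
  have wny : w != y by apply: contraTneq yw => ->; rewrite (no_loop eo).
  have oxny : o x != y by apply: contraTneq xy => <-; rewrite (outlier_nadj eo).
  have oynw : o y != w by apply: contraTneq yw => <-; rewrite (outlier_nadj eo).
  have oxnw : o x != w by apply: contraTneq yw => <-;
    rewrite (outlier_nmid eo xy).
  rewrite /= !inE (inj_eq oinj).
  by rewrite !(neqE _ _ xny, neqE _ _ wnx, neqE _ _ wny, neqE _ _ oxny,
    neqE _ _ oynw, neqE _ _ oxnw, neqE _ _ oyx, neqE _ _ (oxx _)).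
have arc x : e (o x) x.
  have [y xy] : exists y, e x y.
    have := d1 x; rewrite /outdeg => s1; apply/existsP; apply: contraT.
    rewrite negb_exists => /forallP ne; move: s1; rewrite big1 // => w _.
    by rewrite (negPf (ne w)).
  by rewrite -{2}(back _ _ xy) (oaut_arc sys).
have o2 x : o (o x) != x.
  by apply: contraTneq (arc (o x)) => ->; rewrite (no_digon eo (arc x)).
have o3 x : o (o (o x)) != x.
  apply/eqP=> o3x; have [v] : exists v, v \notin [:: x; o x; o (o x)].
    apply/existsP; apply: contraT; rewrite negb_exists => /forallP al.
    have : #|V| <= 3.
      rewrite -cardsT; apply: leq_trans (card_size [:: x; o x; o (o x)]).
      by apply/subset_leq_card/subsetP=> v _; have := al v; rewrite negbK.
    by rewrite V4.
  rewrite !inE !negb_or => /and3P[v1 v2 v3].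
  case: (five [:: x; o x; o (o x); v; o v]) => //=.
  have ovx : o v != x by rewrite -o3x (inj_eq oinj).
  rewrite !inE !(inj_eq oinj).
  by rewrite !(neqE _ _ v1, neqE _ _ v2, neqE _ _ v3, neqE _ _ ovx,
    neqE _ _ (oxx _), neqE _ _ (o2 _)).
move=> x; have : order o x <= 4 by rewrite -V4; apply: max_card.
have := order_outlier_neq1 x; have := order_gt0 o x.
have := iter_dvd_order x 2 oinj; have := iter_dvd_order x 3 oinj.
rewrite /= (negPf (o2 x)) (negPf (o3 x));
  case: (order o x) => [|[|[|[|[|]]]]] //.
Qed.

End SmallDegree.

Section CycleType.
Variables (V : finType) (e : rel V) (o : V -> V) (d : nat).
Hypothesis sys : outlier_aut e o.
Hypothesis reg : forall u, outdeg e u = d.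
Hypothesis IH : forall (V' : finType) (e' : rel V') (o' : V' -> V') d',
  outlier_aut e' o' -> 0 < #|V'| -> (forall u, outdeg e' u = d') ->
  1 < d' < d -> False.
Let eo : is_outlier e o := oaut_outlier sys.
Let oinj : injective o := oaut_inj sys.

(** The fixed points of [o^j] induce a digraph of some degree d'. If d' >= d, it has at least as
    many points as [V]; otherwise [IH] leaves d' = 0 or d' = 1, with 2 or 4 points. *)
Lemma fix_cases j (x0 : V) : order o x0 %| j ->
  (forall y, order o y %| j) \/
  exists2 f, f \in [:: 2; 4] & #|[pred y | order o y %| j]| = f /\
    forall y, order o y %| j -> order o y = f.
Proof.
move=> x0j.
have fixj y : (iter j o y == y) = (order o y %| j) by apply: iter_dvd_order.
pose W := fixT o j; pose x0W : W := exist _ x0 (etrans (fixj x0) x0j).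
have W0 : 0 < #|W| by apply/card_gt0P; exists x0W.
move: (fix_outlier_aut sys j); set eW := (X in outlier_aut X _);
  set oW := (X in outlier_aut _ X) => sysW.
have cardW : #|W| = #|[pred y | order o y %| j]|.
  by rewrite card_sig; apply: eq_card => y; rewrite !inE fixj.
pose d' := indeg eW x0W.
have regW u : outdeg eW u = d' by rewrite (outdeg_indeg sysW u x0W).
have orderW (y : W) : order oW y = order o (val y).
  have valiter k : val (iter k oW y) = iter k o (val y) by elim: k => //= k ->.
  have dv k : (order oW y %| k) = (order o (val y) %| k).
    rewrite -(iter_dvd_order y k (oaut_inj sysW)) -(iter_dvd_order (val y) k
      oinj).
    by rewrite -val_eqE /= valiter.
  by apply/eqP; rewrite eqn_dvd dv dvdnn -dv dvdnn.
have card_d' := card_outlier sysW regW W0.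
have [le_d'|gt_d'] := leqP d d'.
  left=> y; have card_d := card_outlier sys reg.
  have V0 : 0 < #|V| by apply/card_gt0P; exists x0.
  have le_card : #|V| <= #|W| by rewrite card_d // card_d'; nia.
  have /subset_leqif_card/geq_leqif := subset_predT [pred y | order o y %| j].
  by rewrite -cardW le_card => /esym/subsetP/(_ y isT); rewrite inE.
have [|lt2] := ltnP 1 d'; first by move=> ?; case: (IH sysW W0 regW);
  rewrite gt_d' andbT.
right; rewrite -cardW card_d'.
have {lt2} : d' = 0 \/ d' = 1 by lia.
case=> d'E; rewrite d'E; [exists 2 | exists 4] => //; split=> // y yj.
  have := orderW (exist _ y (etrans (fixj y) yj)) => /= <-.
  by apply: (order_outdeg0 sysW) => u; rewrite regW.
have := orderW (exist _ y (etrans (fixj y) yj)) => /= <-.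
by apply: (order_outdeg1 sysW) => // u; rewrite regW.
Qed.

(** Let f be the least order. Any order other than f turns out to be a multiple of all orders, so
    any two such orders agree. *)
Lemma cycle_type : 0 < #|V| ->
  (exists m, forall x, order o x = m) \/
  exists f m, [/\ f \in [:: 2; 4], f %| m, f < m,
    #|[pred x | order o x == f]| = f &
    forall x, order o x != f -> order o x = m].
Proof.
case/card_gt0P=> x1 _; case: (arg_minnP (order o) (isT : xpredT x1)) =>
  x0 _ min0.
have [all0|[f f24 [cardf fixf]]] := fix_cases (dvdnn (order o x0)).
  left; exists (order o x0) => y; apply/eqP; rewrite eqn_leq min0 // andbT.
  by rewrite dvdn_leq ?order_gt0.
have f0 := fixf _ (dvdnn _); rewrite f0 in min0 cardf fixf.
have [/forallP allf|] := boolP [forall y, order o y == f].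
  by left; exists f => y; apply/eqP.
rewrite negb_forall => /existsP[y yf]; right.
have allfix z : order o z != f -> forall x, order o x %| order o z.
  (* In the second case the order of z is 2 or 4 and at least f, hence a multiple of f. Then x0 is
     among the points counted, which all have the order of z, so that order is f. *)
  move=> zf; have [//|[f' f'24 [_ fixf']]] := fix_cases (dvdnn (order o z)).
  have zf' := fixf' _ (dvdnn _); have fz := min0 z isT.
  have x0z : order o x0 %| order o z.
    rewrite f0; move: f24 f'24 fz zf; rewrite zf' !inE.
    by do 2!case/orP=> /eqP->.
  by move: zf; rewrite zf' -(fixf' _ x0z) f0 eqxx.
exists f, (order o y); split=> //.
- by rewrite -f0 allfix.
- by rewrite ltn_neqAle eq_sym yf min0.
- rewrite -[RHS]cardf; apply: eq_card => z; rewrite !inE.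
  by apply/eqP/idP=> [->//|/fixf].
by move=> z zf; apply/eqP; rewrite eqn_dvd !allfix.
Qed.

End CycleType.

(** * Traces on the eigenspaces of the outlier automorphism *)

Section RelationMatrices.
Local Open Scope ring_scope.

Definition relmx (V : finType) (f : V -> V -> algC) : 'M[algC]_#|V| :=
  \matrix_(i, j) f (enum_val i) (enum_val j).

Section RelMx.
Variable V : finType.
Implicit Types f g : V -> V -> algC.

Lemma eq_relmx f g : f =2 g -> relmx f = relmx g.
Proof. by move=> fg; apply/matrixP=> i j; rewrite !mxE fg. Qed.

Lemma relmxM f g : relmx f *m relmx g = relmx (fun u v => \sum_w f u w * g w v).
Proof.
apply/matrixP=> i j; rewrite !mxE [RHS](reindex _ (onW_bij _
  (@enum_val_bij V))).
by apply: eq_bigr => k _; rewrite !mxE.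
Qed.

Lemma relmxD f g : relmx f + relmx g = relmx (fun u v => f u v + g u v).
Proof. by apply/matrixP=> i j; rewrite !mxE. Qed.

Lemma relmxZ a f : a *: relmx f = relmx (fun u v => a * f u v).
Proof. by apply/matrixP=> i j; rewrite !mxE. Qed.

Lemma relmx1 : 1%:M = relmx (fun u v : V => (u == v)%:R).
Proof. by apply/matrixP=> i j; rewrite !mxE (inj_eq enum_val_inj). Qed.

Lemma mxtrace_relmx f : \tr (relmx f) = \sum_u f u u.
Proof.
rewrite /mxtrace [RHS](reindex _ (onW_bij _ (@enum_val_bij V))).
by apply: eq_bigr => k _; rewrite !mxE.
Qed.

Lemma sum_eqr_mul (x : V) (F : V -> algC) : \sum_w (w == x)%:R * F w = F x.
Proof.
by rewrite (bigD1 x) //= eqxx mul1r big1 ?addr0 // => w /negPf ->;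
  rewrite mul0r.
Qed.

End RelMx.

Definition arcmx (V : finType) (e : rel V) := relmx (fun u v => (e u v)%:R).

Lemma outlier_mx (V : finType) (e : rel V) (o : V -> V) : is_outlier e o ->
  arcmx e *m arcmx e + arcmx e + 1%:M + relmx (fun u v => (v == o u)%:R) =
  const_mx 1.
Proof.
move=> eo; rewrite /arcmx relmxM relmx1 !relmxD; apply/matrixP=> i j;
  rewrite !mxE.
move: (enum_val i) (enum_val j) => u v.
have -> : \sum_w (e u w)%:R * (e w v)%:R = (\sum_w e u w * e w v)%N%:R :> algC.
  by rewrite natr_sum; apply: eq_bigr => w _; rewrite natrM.
rewrite -!natrD -[RHS](mulr1n 1); congr (1 *+ _).
by have := eo u v; rewrite /walks2; case: (v == o u) => /=; lia.
Qed.

Section Spectral.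
Variables (V : finType) (e : rel V) (o : V -> V) (d m : nat).
Hypothesis sys : outlier_aut e o.
Hypothesis reg : forall u, outdeg e u = d.
Hypothesis m0 : (0 < m)%N.
Hypothesis period : forall x, iter m o x = x.
Let oinj : injective o := oaut_inj sys.

Let A := arcmx e.
Let J : 'M[algC]_#|V| := const_mx 1.
Let P := relmx (fun u v => (v == o u)%:R).
(** [R j] is P^-j; this sign makes the trace of [A *m R j] count the arcs from x to [o^j x]. *)
Let R j := relmx (fun u v => (u == iter j o v)%:R).
Let T z := \sum_(j < m) z ^+ j *: R j.

Let RM i j : R i *m R j = R (i + j)%N.
Proof.
rewrite relmxM; apply: eq_relmx => u v.
under eq_bigr do rewrite mulrC; by rewrite sum_eqr_mul iterD.
Qed.

Let R0 : R 0 = 1%:M. Proof. by rewrite relmx1. Qed.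
Let Rm : R m = 1%:M. Proof. by rewrite relmx1; apply: eq_relmx => u v;
  rewrite period. Qed.

Let PR1 : P *m R 1 = 1%:M.
Proof.
rewrite relmxM relmx1; apply: eq_relmx => u v.
by rewrite sum_eqr_mul (inj_eq oinj).
Qed.

Let AR j : A *m R j = relmx (fun u v => (e u (iter j o v))%:R).
Proof.
rewrite relmxM; apply: eq_relmx => u v.
by under eq_bigr do rewrite mulrC; rewrite sum_eqr_mul.
Qed.

Let RA j : R j *m A = A *m R j.
Proof.
rewrite AR relmxM; apply: eq_relmx => u v.
rewrite -[RHS](sum_eqr_mul u (fun w => (e w (iter j o v))%:R)).
rewrite [RHS](reindex_inj (@iter_o_inj _ _ _ sys j)).
by apply: eq_bigr => w _; rewrite (arc_iter sys) eq_sym.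
Qed.

Let JR j : J *m R j = J.
Proof.
have -> : J = relmx (fun _ _ => 1) by apply/matrixP=> a b; rewrite !mxE.
rewrite relmxM; apply: eq_relmx => u v.
by under eq_bigr do rewrite mulrC; rewrite sum_eqr_mul.
Qed.

Let RJ j : R j *m J = J.
Proof.
have -> : J = relmx (fun _ _ => 1) by apply/matrixP=> a b; rewrite !mxE.
rewrite relmxM; apply: eq_relmx => u v.
rewrite -[RHS](sum_eqr_mul u (fun=> 1))
  [RHS](reindex_inj (@iter_o_inj _ _ _ sys j)).
by apply: eq_bigr => w _; rewrite eq_sym.
Qed.

Let AT z : A *m T z = T z *m A.
Proof.
rewrite mulmx_sumr mulmx_suml; apply: eq_bigr => j _.
by rewrite -scalemxAr -scalemxAl RA.
Qed.

(** Multiplication by [z *: R 1] permutes the terms of [T z] cyclically, because z^m = 1 and [R m]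
    is the identity. *)
Let RjT z j : z ^+ m = 1 -> z ^+ j *: (R j *m T z) = T z.
Proof.
move=> zm; elim: j => [|j IH]; first by rewrite R0 mul1mx scale1r.
have shift : z *: (R 1 *m T z) = T z.
  rewrite mulmx_sumr scaler_sumr /T; case: m m0 zm Rm => // k _ zm RR.
  rewrite big_ord_recr big_ord_recl /= addrC; congr (_ + _).
    by rewrite -scalemxAr scalerA -exprS zm RM add1n RR R0.
  by apply: eq_bigr => i _; rewrite -scalemxAr scalerA -exprS RM.
rewrite -[RHS]IH -[in RHS]shift -scalemxAr mulmxA RM addn1 scalerA.
by rewrite -exprSr.
Qed.

Let TT z : z ^+ m = 1 -> T z *m T z = m%:R *: T z.
Proof.
move=> zm; rewrite {1}/T mulmx_suml.
under eq_bigr => j _ do rewrite -scalemxAl RjT //.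
by rewrite sumr_const card_ord scaler_nat.
Qed.

Let PT z : z ^+ m = 1 -> P *m T z = z *: T z.
Proof.
move=> zm; rewrite -{1}(RjT 1 zm) expr1 -scalemxAr mulmxA PR1 mul1mx //.
Qed.

Let mnz : m%:R != 0 :> algC. Proof. by rewrite pnatr_eq0 -lt0n. Qed.

Let JT z : z ^+ m = 1 -> z != 1 -> J *m T z = 0.
Proof.
move=> zm z1; apply/eqP; have /eqP := congr1 (mulmx J) (RjT 1 zm).
rewrite expr1 -scalemxAr mulmxA JR -subr_eq0 -{2}[_ *m _]scale1r -scalerBl.
by rewrite scaler_eq0 subr_eq0 (negPf z1).
Qed.

Let quadE : A *m A + A + 1%:M + P = J := outlier_mx (oaut_outlier sys).

Let trT z : \tr (T z) = \sum_(j < m) z ^+ j * (\sum_x (iter j o x == x))%N%:R.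
Proof.
rewrite linear_sum; apply: eq_bigr => j _;
  rewrite linearZ /= mxtrace_relmx natr_sum.
by congr (_ * _); apply: eq_bigr => x _; rewrite eq_sym.
Qed.

Let trAT z : \tr (A *m T z) = \sum_(j < m) z ^+ j *
  (\sum_x e x (iter j o x))%N%:R.
Proof.
rewrite mulmx_sumr linear_sum; apply: eq_bigr => j _.
by rewrite -scalemxAr linearZ /= AR mxtrace_relmx natr_sum.
Qed.

(* T z / m is the projection onto the eigenspace of P for z. *)
Lemma trace_root (z a b : algC) :
    z ^+ m = 1 -> z != 1 -> a != b -> a + b = -1 -> a * b = 1 + z ->
  exists q : nat,
    \sum_(j < m) z ^+ j * (\sum_x e x (iter j o x))%N%:R -
      a * \sum_(j < m) z ^+ j * (\sum_x (iter j o x == x))%N%:R =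
      (b - a) * (m%:R * q%:R)
    /\ (q = 0%N -> forall u v, \sum_(j < m) z ^+ j * (e u (iter j o v))%:R =
                    a * \sum_(j < m) z ^+ j * (u == iter j o v)%:R).
Proof.
move=> zm z1 nab abS abP; pose E := m%:R^-1 *: T z.
have EE : E *m E = E.
  by rewrite -scalemxAl -scalemxAr TT // [X in _ *: X]scalerA mulVf // scale1r.
have AE : A *m E = E *m A by rewrite -scalemxAr -scalemxAl AT.
have [|q [trq q0]] := idem_trace_split nab EE AE.
  rewrite abS abP scaleN1r opprK -!scalemxAr !scalerA mulrC -scalerA -!scalerDr.
  apply/eqP; rewrite scaler_eq0; apply/orP; right; apply/eqP.
  rewrite -(JT zm z1) -quadE !mulmxDl mul1mx PT // scalerDl scale1r.
  by rewrite !addrA.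
exists q; split=> [|/q0 AEa u v].
  by rewrite -trAT -trT mulrCA -trq /E -scalemxAr !mxtraceZ; field.
have : A *m T z = a *: T z.
  have mnz' : m%:R^-1 != 0 :> algC by rewrite invr_eq0.
  by apply: (scalerI mnz'); rewrite scalerA mulrC -scalerA scalemxAr.
move/matrixP/(_ (enum_rank u) (enum_rank v)).
rewrite mulmx_sumr mxE !summxE.
under eq_bigr => j _ do rewrite -scalemxAr AR !mxE !enum_rankK.
by under [X in _ = _ * X -> _]eq_bigr => j _ do rewrite !mxE !enum_rankK.
Qed.

(* At z = 1 the projection also removes the constant vectors. *)
Lemma trace_one : (0 < #|V|)%N -> exists k : nat,
  (\sum_(j < m) \sum_x (iter j o x == x) = m * (1 + 2 * k))%N
  /\ (\sum_(j < m) \sum_x e x (iter j o x) + m * k = m * d)%N.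
Proof.
move=> V0; have nnz : #|V|%:R != 0 :> algC by rewrite pnatr_eq0 -lt0n.
have one : 1 ^+ m = 1 :> algC by rewrite expr1n.
have JJ : J *m J = #|V|%:R *: J.
  apply/matrixP=> i j; rewrite !mxE; under eq_bigr do rewrite !mxE mulr1.
  by rewrite sumr_const card_ord mulr1.
have JT1 : J *m T 1 = m%:R *: J.
  rewrite mulmx_sumr; under eq_bigr do rewrite expr1n scale1r JR.
  by rewrite sumr_const card_ord scaler_nat.
have TJ1 : T 1 *m J = m%:R *: J.
  rewrite mulmx_suml; under eq_bigr do rewrite expr1n scale1r RJ.
  by rewrite sumr_const card_ord scaler_nat.
have JE1 : J = relmx (fun _ _ => 1) by apply/matrixP=> a b; rewrite !mxE.
have AJ : A *m J = d%:R *: J.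
  rewrite JE1 relmxM relmxZ; apply: eq_relmx => u v.
  by under eq_bigr do rewrite mulr1; rewrite mulr1 -natr_sum -/(outdeg e u) reg.
have JA : J *m A = d%:R *: J.
  rewrite JE1 relmxM relmxZ; apply: eq_relmx => u v.
  under eq_bigr do rewrite mul1r.
  by rewrite mulr1 -natr_sum -/(indeg e v) -(outdeg_indeg sys u v) reg.
have PJ : P *m J = J.
  rewrite JE1 relmxM; apply: eq_relmx => u v.
  by rewrite sum_eqr_mul.
pose E := m%:R^-1 *: T 1 - #|V|%:R^-1 *: J.
have TE : T 1 *m E = m%:R *: E.
  rewrite mulmxBr -!scalemxAr TT // TJ1 scalerBr !scalerA.
  by rewrite [m%:R / _]mulrC [m%:R^-1 * _]mulrC [_ / #|V|%:R]mulrC.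
have JE : J *m E = 0.
  by rewrite mulmxBr -!scalemxAr JT1 JJ !scalerA !mulVf // subrr.
have EE : E *m E = E.
  by rewrite {1}/E mulmxBl -!scalemxAl TE JE scaler0 subr0 scalerA mulVf //
    scale1r.
have AE : A *m E = E *m A.
  by rewrite mulmxBr mulmxBl -!scalemxAr -!scalemxAl AT AJ JA.
have PE : P *m E = E.
  by rewrite mulmxBr -!scalemxAr PT // scale1r PJ.
(* On the image of E the matrix P is the identity and J vanishes, so A is a root of x^2 + x + 2. *)
have quad : A *m A *m E + A *m E + 2 *: E = 0.
  rewrite -JE -quadE !mulmxDl mul1mx PE.
  by rewrite scaler_nat mulr2n addrA.
pose f := (\sum_(j < m) \sum_x (iter j o x == x))%N.
pose t := (\sum_(j < m) \sum_x e x (iter j o x))%N.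
have trE : \tr E = f%:R / m%:R - 1.
  rewrite raddfB /= !mxtraceZ trT mulrC; congr (_ / _ - _).
    by rewrite natr_sum; apply: eq_bigr => j _; rewrite expr1n mul1r.
  rewrite /mxtrace; under eq_bigr do rewrite mxE.
  by rewrite sumr_const card_ord mulVf.
have trAE : \tr (A *m E) = t%:R / m%:R - d%:R.
  rewrite mulmxBr raddfB /= -!scalemxAr AJ !mxtraceZ trAT mulrC;
    congr (_ / _ - _).
    by rewrite natr_sum; apply: eq_bigr => j _; rewrite expr1n mul1r.
  rewrite /mxtrace; under eq_bigr do rewrite mxE.
  by rewrite sumr_const card_ord mulrCA mulVf ?mulr1.
have [|||q [trE2 trAE2]] := real_trace_split (c := 2) _ EE AE quad.
- by rewrite -natrM ltr1n.
- by rewrite trE realB // realM ?realV ?realn.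
- by rewrite trAE realB ?realn // realM ?realV ?realn.
exists q; split; apply/eqP; rewrite -(eqr_nat algC) -/f -/t ?natrD !natrM;
  apply/eqP.
  by rewrite natrD natrM -trE2 trE; field.
have -> : q%:R = - \tr (A *m E) by rewrite trAE2 opprK.
by rewrite trAE; field.
Qed.

End Spectral.

End RelationMatrices.

(** * Non-existence for diregular digraphs *)

Lemma sum_dvdn m c : c %| m -> \sum_(j < m) (c %| j) = m %/ c.
Proof.
(* The quotient counts multiples in 1..m, the sum those in 0..m-1. Adding 1 to both compensates for
   trading the multiple 0 for m. *)
move=> cm; rewrite divn_count_dvd; apply: (@addIn 1).
rewrite -(big_mkord xpredT (fun j => nat_of_bool (c %| j))).
rewrite -{1}[1](congr1 nat_of_bool cm) -(big_nat_recr _ _ (fun j =>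
  nat_of_bool (c %| j))) //.
by rewrite big_nat_recl // dvdn0 addnC big_add1.
Qed.

Section Orbits.
Variables (V : finType) (e : rel V) (o : V -> V) (d m : nat).
Hypothesis sys : outlier_aut e o.
Hypothesis reg : forall u, outdeg e u = d.
Hypothesis m0 : 0 < m.
Hypothesis dvm : forall x, order o x %| m.
Let eo : is_outlier e o := oaut_outlier sys.
Let oinj : injective o := oaut_inj sys.

Lemma iter_period x : iter m o x = x.
Proof. by apply/eqP; rewrite iter_dvd_order. Qed.

Lemma sum_orbit_fix x : \sum_(j < m) (iter j o x == x) = m %/ order o x.
Proof. by rewrite -sum_dvdn //; apply: eq_bigr => j _; rewrite iter_dvd_order.
Qed.

(** By [orbit_arc_uniq] all arcs from x into its own orbit end at one vertex [o^a x]; the shift [h]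
    by a turns hits of that vertex into hits of x. *)
Lemma orbit_arcs_le x : \sum_(j < m) e x (iter j o x) <= m %/ order o x.
Proof.
have [/existsP[a xa]|] := boolP [exists a : 'I_m, e x (iter a o x)]; last first.
  rewrite negb_exists => /forallP na; rewrite big1 // => j _.
  by rewrite (negPf (na j)).
have iter_mod k : iter (k %% m) o x = iter k o x.
  rewrite {2}(divn_eq k m) addnC iterD; congr (iter _ _ _).
  elim: (k %/ m) => [|q IH] //=.
  by rewrite mulSn iterD -IH iter_period.
pose h (j : 'I_m) : 'I_m := Ordinal (ltn_pmod (j + a) m0).
have hinj : injective h.
  move=> i j /(congr1 val)/eqP /=; rewrite eqn_modDr !modn_small // => /eqP.
  exact: val_inj.
rewrite -sum_orbit_fix (reindex_inj hinj) /=; apply: leq_sum => j _.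
rewrite iter_mod; case xja: (e x _) => //; have := orbit_arc_uniq sys xja xa.
by rewrite addnC iterD => /(iter_o_inj sys) ->; rewrite eqxx.
Qed.

Lemma orbit_arcs2 x : order o x = 2 -> \sum_(j < m) e x (iter j o x) = 0.
Proof.
move=> o2; have oox : o (o x) = x by apply/eqP;
  have := iter_dvd_order x 2 oinj; rewrite o2.
rewrite big1 // => j _; have : iter j o x = x \/ iter j o x = o x.
  by elim: (nat_of_ord j) => [|k [] /= ->]; auto.
by case=> ->; rewrite ?(no_loop eo) ?(outlier_nadj eo).
Qed.

(** Each cycle of [o] contributes m to the first sum, so [o] has 1 + 2k cycles. *)
Lemma orbit_trace : 0 < #|V| -> exists2 k,
  \sum_x m %/ order o x = m * (1 + 2 * k) &
  \sum_x \sum_(j < m) e x (iter j o x) + m * k = m * d.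
Proof.
move=> V0; have [k [f t]] := trace_one sys reg m0 iter_period V0.
exists k; last by rewrite exchange_big.
by rewrite -f exchange_big; apply: eq_bigr => x _; rewrite sum_orbit_fix.
Qed.

End Orbits.

(** * The three exceptional cycle types *)

Section Exceptional.
Variables (V : finType) (e : rel V) (o : V -> V).
Hypothesis sys : outlier_aut e o.
Let eo : is_outlier e o := oaut_outlier sys.
Let oinj : injective o := oaut_inj sys.

Lemma outdeg_gt0 d : (forall u, outdeg e u = d.+1) -> forall u, exists v, e u v.
Proof.
move=> reg u; apply/existsP; apply: contraT; rewrite negb_exists => /forallP nu.
by have := reg u; rewrite /outdeg big1 // => v _; rewrite (negPf (nu v)).
Qed.

(** At z = -1 the roots are 0 and -1. No arc joins two points of one cycle, so the root -1 has
    multiplicity 0 and A vanishes on the eigenspace. Thus w and [o w] have the same in-neighbours,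
    and as [o w] also shares out-neighbours with w, middle vertices are not unique. *)
Lemma no_involutory d : (forall u, outdeg e u = d.+1) -> 0 < #|V| ->
  (forall x, order o x = 2) -> False.
Proof.
move=> reg V0 o2; have oo x : o (o x) = x.
  by apply/eqP; have := iter_dvd_order x 2 oinj; rewrite o2.
have z1 : (-1 != 1 :> algC)%R.
  by rewrite eq_sym -subr_eq0 opprK -(natrD _ 1 1) pnatr_eq0.
have ab : (0 != -1 :> algC)%R by rewrite eq_sym oppr_eq0 oner_eq0.
have [||| q] := trace_root sys (isT : 0 < 2) oo _ z1 ab.
- by rewrite sqrrN expr1n.
- by rewrite add0r.
- by rewrite mul0r subrr.
have t0 : \sum_x e x x = 0 by rewrite big1 // => x _; rewrite (no_loop eo).
have t1 : \sum_x e x (o x) = 0.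
  by rewrite big1 // => x _; rewrite (outlier_nadj eo).
rewrite !big_ord_recl !big_ord0 /= t0 t1 !mulr0 !addr0 !mul0r sub0r.
case=> /esym/eqP; rewrite subr0 mulN1r oppr0 oppr_eq0 -natrM pnatr_eq0 =>
  /eqP q0 ae.
have eoE u v : e u v = e u (o v).
  have := ae _ u v; rewrite !big_ord_recl !big_ord0 /= expr0 expr1 mul1r mulN1r
    addr0 mul0r.
  case: q q0 {ae} => // _ /(_ erefl)/eqP; rewrite subr_eq0 eqr_nat.
  by case: (e u v); case: (e u (o v)).
have /card_gt0P[u _] := V0; have [w uw] := outdeg_gt0 reg u;
  have [v wv] := outdeg_gt0 reg w.
have uow : e u (o w) by rewrite -eoE.
have owv : e (o w) v by rewrite eoE (oaut_arc sys).
by have /eqP := mid_uniq eo uow owv uw wv; rewrite (negPf (outlier_neq eo w)).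
Qed.

(** The count at z = 1 gives exactly 4 arcs x -> o^3 x and none to the other points of the cycle. At
    z = i, with roots -i and i - 1, these counts admit no real multiplicity. *)
Lemma no_order4 : (forall u, outdeg e u = 6) -> 0 < #|V| ->
  (forall x, order o x = 4) -> False.
Proof.
move=> reg V0 o4; have oo x : iter 4 o x = x.
  by apply/eqP; rewrite iter_dvd_order // o4.
have V44 := card_outlier sys reg V0.
have fix0 k : 0 < k < 4 -> \sum_x (iter k o x == x) = 0.
  move=> k4; rewrite big1 // => x _; rewrite iter_dvd_order // o4.
  by case: k k4 => [|[|[|[|]]]].
have t0 : \sum_x e x x = 0 by rewrite big1 // => x _; rewrite (no_loop eo).
have t1 : \sum_x e x (o x) = 0.
  by rewrite big1 // => x _; rewrite (outlier_nadj eo).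
have t2 : \sum_x e x (o (o x)) = 0.
  rewrite big1 // => x _; apply/eqP; rewrite eqb0; apply/negP=> /[dup] xx.
  by rewrite -(arc_iter sys 2) /= (oo x : o (o (o (o x))) = x) (no_digon eo xx).
have f0 : \sum_(x : V) (x == x) = 44.
  by under eq_bigr do rewrite eqxx; rewrite sum1_card V44.
have f1 := fix0 1 isT; have f2 := fix0 2 isT; have f3 := fix0 3 isT.
have [k []] := trace_one sys reg (isT : 0 < 4) oo V0.
rewrite !big_ord_recl !big_ord0 /= f0 f1 f2 f3 t0 t1 t2 => kE t3E.
have {kE t3E} t3 : \sum_x e x (o (o (o x))) = 4 by move: t3E; rewrite /bump /=;
  lia.
have i2 : ('i ^+ 2 = -1 :> algC)%R by apply: sqrCi.
have i1 : ('i != 1 :> algC)%R.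
  by apply: contra_eq_neq i2 => ->;
    rewrite expr1n -subr_eq0 opprK -(natrD _ 1 1) pnatr_eq0.
(* Equality would mean 2 i - 1 = 0, but (2 i + 1) (2 i - 1) = -5. *)
have iab : (- 'i != 'i - 1 :> algC)%R.
  apply/eqP => iE; have : (- 5%:R = 0 :> algC)%R.
    have -> : (- 5%:R = (2 * 'i + 1) * (- (- 'i) + 'i - 1) - 4 * ('i ^+ 2 + 1)
      :> algC)%R by ring.
    by rewrite i2 iE; ring.
  by apply/eqP; rewrite oppr_eq0 pnatr_eq0.
have [||| q [trq _]] := trace_root sys (isT : 0 < 4) oo _ i1 iab.
- by rewrite (exprM _ 2 2) i2 sqrrN expr1n.
- by rewrite addrA addNr add0r.
- by rewrite mulrBr mulr1 mulNr -expr2 i2 !opprK.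
move: trq; rewrite !big_ord_recl !big_ord0 /= f0 f1 f2 f3 t0 t1 t2 t3.
move=> /eqP; rewrite -subr_eq0 => /eqP; set y := (X in (X = 0)%R -> _) => y0.
(* The trace identity reads 10 i = (2 i - 1) q; multiply it by its conjugate. *)
have : ((q%:R - 4) ^+ 2 + 4 = 0 :> algC)%R.
  have yE : (y = 4 * ('i * (10%:R - 2 * q%:R) + q%:R) + 4 * 'i * ('i ^+ 2 +
    1))%R.
    by rewrite /y /bump /=; ring.
  (* The squared norm of q + i (10 - 2 q) is q^2 + (10 - 2 q)^2 = 5 ((q - 4)^2 + 4); the terms with
     i^2 + 1 make this a polynomial identity. *)
  have -> : ((q%:R - 4) ^+ 2 + 4 = 20%:R^-1 * (q%:R - 'i * (10%:R - 2 * q%:R)) *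
    (y - 4 * 'i * ('i ^+ 2 + 1)) + 5%:R^-1 * ('i ^+ 2 + 1) * (10%:R - 2 * q%:R)
      ^+ 2 :> algC)%R.
    by rewrite yE; field.
  by rewrite y0 i2; ring.
apply/eqP/lt0r_neq0/ltr_wpDl; last by rewrite ltr0n.
by rewrite -realEsqr realB ?realn.
Qed.

(* One 2-cycle of o and otherwise 6-cycles.  Every x in a 6-cycle has an arc to
   o^2 x, o^4 x or o^5 x, and for the neighbours of the 2-cycle it is o^5 x. *)
Lemma no_order26 : (forall u, outdeg e u = 3) -> 0 < #|V| ->
    (exists2 a, order o a = 2 & forall x, order o x = 2 -> x = a \/ x = o a) ->
    (forall x, order o x = 2 \/ order o x = 6) ->
    (forall x, order o x = 6 -> \sum_(j < 6) e x (iter j o x) = 1) ->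
  False.
Proof.
move=> reg V0 [a oa aF] o26 arc1.
have o2 x : (order o x == 2) = (o (o x) == x).
  rewrite -[o (o x)]/(iter 2 o x) iter_dvd_order //.
  by case: (o26 x) => ->.
have o6 x : iter 6 o x = x.
  by apply/eqP; rewrite iter_dvd_order //; case: (o26 x) => ->.
have step x : order o x = 6 ->
    [|| e x (iter 2 o x), e x (iter 4 o x) | e x (iter 5 o x)].
  move/arc1; rewrite !big_ord_recl big_ord0 /= (no_loop eo) (outlier_nadj eo).
  suff -> : e x (o (o (o x))) = false by rewrite /bump /=; do 3!case: (e x _).
  apply/negP=> /[dup] x3; rewrite -(arc_iter sys 3) /=
    (o6 x : o (o (o (o (o (o x))))) = x).
  by rewrite (no_digon eo x3).
pose fixed x := o (o x) = x.
have step5 x y : fixed x -> order o y = 6 -> e x y || e y x -> e y (iter 5 o y).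
  move=> fx oy xy; have fx4 : iter 4 o x = x by rewrite /= !fx.
  (* If [o^k] fixes x, then y and [o^k y] are joined to x in the same direction, so an arc y -> o^k
     y would create a shortcut. *)
  have out k : iter k o x = x -> e x y || e y x -> e y (iter k o y) = false.
    move=> kx; case/orP=> h; apply/negP=> yk.
      have := no_shortcut eo h yk; have := h; rewrite -(arc_iter sys k) kx.
      by move=> ->.
    by have := no_shortcut eo yk (v := x);
      rewrite -{1}kx arc_iter // h => /(_ isT).
  by have := step y oy; rewrite (out 2 fx xy) (out 4 fx4 xy).
have fa : fixed a by apply/eqP; rewrite -o2 oa.
have [y ya] : exists y, e y a.
  apply/existsP; apply: contraT; rewrite negb_exists => /forallP na.
  have := reg a; rewrite (outdeg_indeg sys a a) /indeg big1 // => y _.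
  by rewrite (negPf (na y)).
have aao : e a (o a) = false := outlier_nadj eo a.
have oaa : e (o a) a = false by rewrite -(oaut_arc sys) fa.
have oy : order o y = 6.
  by case: (o26 y) => // /aF[] yE; move: ya; rewrite yE ?oaa ?(no_loop eo).
(* This gives a directed triangle a -> x -> y -> a. *)
have [|||x ax xy] := reach2 eo (u := a) (v := y).
- by apply: contraTneq ya => ->; rewrite oaa.
- by apply: contraTneq ya => <-; rewrite (no_loop eo).
- by rewrite (no_digon eo ya).
have ox : order o x = 6.
  by case: (o26 x) => // /aF[] xE; move: ax; rewrite xE ?aao ?(no_loop eo).
have x5 : e x (iter 5 o x) by apply: (step5 a); rewrite ?ax.
have y5 : e y (iter 5 o y) by apply: (step5 a); rewrite ?ya ?orbT.
(* Both are middle vertices of walks of length 2 from x to [o^5 y]. Then x = o y, and x -> o a -> y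
   bypasses the arc x -> y. *)
have yE : y = iter 5 o x.
  by apply: (mid_uniq eo xy y5 x5); rewrite (arc_iter sys).
have xoa : e x (o a) by rewrite -(o6 x) -[iter 6 o x]/(o (iter 5 o x)) -yE
  (oaut_arc sys).
have oay : e (o a) y by rewrite yE -(arc_iter sys 5) /= !fa in ax *.
by have := no_shortcut eo xoa oay; rewrite xy.
Qed.

End Exceptional.

(** * Induction on the degree *)

Lemma no_outlier_aut d : d <= 6 ->
  forall (V : finType) (e : rel V) (o : V -> V),
  outlier_aut e o -> 0 < #|V| -> (forall u, outdeg e u = d) -> 1 < d -> False.
Proof.
elim/ltn_ind: d => d IHd d6 V e o sys V0 reg d1.
have IH (V' : finType) (e' : rel V') (o' : V' -> V') d' :
  outlier_aut e' o' -> 0 < #|V'| -> (forall u, outdeg e' u = d') ->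
    1 < d' < d -> False.
  move=> sys' V'0 reg' /andP[d'1 d'd].
  by apply: (IHd d' d'd _ _ _ _ sys' V'0 reg' d'1);
    apply: leq_trans (ltnW d'd) d6.
have dcase : d = 2 \/ d = 3 \/ d = 4 \/ d = 5 \/ d = 6 by lia.
have cardV := card_outlier sys reg V0.
have [[m ordm]|[f [m [f24 fm fltm cardf ordm]]]] := cycle_type sys reg IH V0.
  have m0 : 0 < m by have /card_gt0P[x _] := V0; rewrite -(ordm x) order_gt0.
  have dvm x : order o x %| m by rewrite ordm.
  have [k nE tE] := orbit_trace sys reg m0 dvm V0.
  have : \sum_x \sum_(j < m) e x (iter j o x) <= \sum_x m %/ order o x.
    by apply: leq_sum => x _; apply: orbit_arcs_le.
  move: nE; under eq_bigr do rewrite ordm divnn m0 /=.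
  rewrite sum1_card cardV => nE tle.
  have kd : k <= d by move: tE; nia.
  (* The constraints are d^2 + d + 2 = m (1 + 2k), k <= d and, from [tE] and [tle], d <= 1 + 3k. *)
  have [[dE mE]|[dE mE]] : (d = 3 /\ m = 2) \/ (d = 6 /\ m = 4).
  - have k6 : k = 0 \/ k = 1 \/ k = 2 \/ k = 3 \/ k = 4 \/ k = 5 \/ k = 6
      by lia.
    by case: dcase => [|[|[|[]]]] dE; move: nE tE tle kd; rewrite dE;
      case: k6 => [|[|[|[|[|[]]]]]] ->; lia.
  - by apply: (no_involutory sys (d := 2)) => // x; rewrite ?reg ?ordm.
  by apply: (no_order4 sys) => // x; rewrite ?reg ?ordm.
have f0 : 0 < f by move: f24; rewrite !inE => /orP[]/eqP->.
have m0 : 0 < m by apply: leq_trans fltm.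
have ordfm x : order o x = f \/ order o x = m.
  by case: (eqVneq (order o x) f) => [|/ordm]; auto.
have dvm x : order o x %| m by case: (ordfm x) => ->.
have [k nE tE] := orbit_trace sys reg m0 dvm V0.
have sumf (a b : nat) : \sum_x (if order o x == f then a else b) =
    f * a + (#|V| - f) * b.
  rewrite big_if /= !sum_nat_const; congr (_ * _ + _ * _); first exact: cardf.
  have := cardC [pred x | order o x == f]; rewrite cardf => <-; rewrite addKn.
  by apply: eq_card => x; rewrite !inE.
have fV : f <= #|V| by rewrite -cardf max_card.
(* The f points of order f form one of the 1 + 2k cycles; the other 2k have length m. *)
have {}nE : #|V| - f = 2 * k * m.
  have -> : 2 * k * m = \sum_x m %/ order o x - m by rewrite nE; lia.
  rewrite (eq_bigr (fun x => if order o x == f then m %/ f else 1)).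
    by rewrite sumf mulnC divnK // muln1; lia.
  move=> x _; case: eqP => [->//|/eqP/ordm->]; by rewrite divnn m0.
have tle : \sum_x \sum_(j < m) e x (iter j o x) <=
    (if f == 2 then 0 else m) + (#|V| - f).
  apply: (@leq_trans (\sum_x (if order o x == f then
    if f == 2 then 0 else m %/ f else 1))).
    apply: leq_sum => x _; case: eqP => [xf|/eqP/ordm xm].
      case: eqP => [f2|_]; first by rewrite (orbit_arcs2 _ sys) // xf.
      by rewrite -xf; apply: orbit_arcs_le.
    by have := orbit_arcs_le sys m0 dvm x; rewrite xm divnn m0.
  by rewrite sumf muln1; case: eqP => _; rewrite ?muln0 // mulnC divnK.
have [q mE] : exists q, m = f * q by exists (m %/ f); rewrite mulnC divnK.
(* Here d^2 + d + 2 - f = 2 k m with m a proper multiple of f, and the traces give d <= 3k if f = 2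
   and d <= 3k + 1 if f = 4. *)
have [f2 [dE m6]] : f = 2 /\ (d = 3 /\ m = 6).
  move: fltm nE tE tle; rewrite cardV mE => fltm nE tE tle.
  have q1 : 1 < q by case: q fltm {nE tE mE tle} => [|[|]]; lia.
  have k1 : 0 < k.
    by case: k nE {tE} => //; case: dcase => [|[|[|[]]]] ->; move: f24;
      rewrite !inE => /orP[]/eqP->; lia.
  move: f24; rewrite !inE => /orP[]/eqP fE; move: nE tE tle;
    rewrite fE /= => nE tE tle.
    have q5 : q <= 10 by case: dcase => [|[|[|[]]]] dE; rewrite dE in nE; nia.
    have : q \in iota 0 11 by rewrite mem_iota.
    by rewrite !inE; case: dcase => [|[|[|[]]]] dE; move: nE tE tle;
      rewrite dE; lia.
  have q5 : q <= 5 by case: dcase => [|[|[|[]]]] dE; rewrite dE in nE; nia.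
  have qcase : q = 2 \/ q = 3 \/ q = 4 \/ q = 5 by lia.
  by case: dcase => [|[|[|[]]]] dE; move: nE tE tle; rewrite dE;
    case: qcase => [|[|[]]] ->; lia.
clear q mE; subst f d m; have oinj := oaut_inj sys.
apply: (no_order26 sys reg V0 _ ordfm) => [|x x6].
  have /card_gt0P[a] : 0 < #|[pred x | order o x == 2]| by rewrite cardf.
  rewrite inE => /eqP oa; exists a => // x ox.
  have oao : order o (o a) = 2.
    case: (ordfm (o a)) => // o6; have := iter_dvd_order (o a) 2 oinj.
    by rewrite o6 /= (inj_eq oinj) -[o (o a)]/(iter 2 o a) iter_dvd_order // oa.
  have sub : pred2 a (o a) \subset [pred x | order o x == 2].
    by apply/subsetP=> z; rewrite !inE => /orP[]/eqP->; rewrite ?oa ?oao.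
  have /geq_leqif := subset_leqif_card sub.
  rewrite cardf card2 eq_sym (outlier_neq (oaut_outlier sys)) /= =>
    /esym/subsetP/(_ x).
  by rewrite !inE ox eqxx => /(_ isT)/orP[]/eqP; auto.
have le1 y : \sum_(j < 6) e y (iter j o y) <= (if order o y == 2 then 0 else 1).
  have := orbit_arcs_le sys m0 dvm y; case: eqP => [y2|/eqP/ordm y6];
    last by rewrite y6.
  by rewrite (orbit_arcs2 _ sys).
(* Now k = 1, so the total is 18 - 6 = 12, one for each point of order 6; hence the bound [le1] is
   attained at every point. *)
have /leqif_sum : forall y, true -> \sum_(j < 6) e y (iter j o y) <=
    (if order o y == 2 then 0 else 1) ?= iff
    (\sum_(j < 6) e y (iter j o y) == if order o y == 2 then 0 else 1).
  by move=> y _; apply: leqif_eq.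
case=> _; rewrite sumf => all_eq.
have : \sum_y \sum_(j < 6) e y (iter j o y) == 2 * 0 + (#|V| - 2) * 1.
  by apply/eqP; move: nE tE; rewrite cardV; lia.
by rewrite all_eq => /forallP/(_ x); rewrite x6 /= => /eqP.
Qed.

(** * Diregularity *)

Section TwinOutliers.
Local Open Scope ring_scope.

(* Identifying s and t, whose adjacency matrix is B below, gives a digraph with
   I + B + B^2 = J in which the trace of B cannot vanish. *)
Lemma card_twin_outliers (V : finType) (e : rel V) (o : V -> V) d s t :
    is_outlier e o -> (forall u, outdeg e u = d) -> s != t ->
    (forall v, e s v = e t v) -> (forall u, o u = s \/ o u = t) ->
  #|V| = (2 * d + 2)%N.
Proof.
move=> eo reg st twin os_t; have n2 : (1 < #|V|)%N.
  by apply/card_gt1P; exists s, t.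
pose phi u := if u == t then s else u.
pose A := arcmx e; pose S := relmx (fun u v : V => (v == phi u)%:R).
pose L := relmx (fun _ v : V => (v != t)%:R); pose n1 : algC := #|V|.-1%:R.
have n1nz : n1 != 0 by rewrite pnatr_eq0; lia.
have sumt : \sum_v (v != t)%:R = n1.
  rewrite -natr_sum; congr (_%:R);
    rewrite -(cardC1 t) -sum1_card [RHS]big_mkcond.
  by apply: eq_bigr => v _; rewrite inE.
have phit u : phi u != t by rewrite /phi; case: (eqVneq u t).
have relS f : relmx f *m S = relmx (fun u v => \sum_w f u w * (v == phi w)%:R).
  exact: relmxM.
have Srel f : S *m relmx f = relmx (fun u v => f (phi u) v).
  by rewrite relmxM; apply: eq_relmx => u v; rewrite sum_eqr_mul.
have SA : S *m A = A.
  rewrite Srel; apply: eq_relmx => u v; rewrite /phi.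
  by case: eqP => // ->; rewrite twin.
have SL : S *m L = L by rewrite Srel.
have SS : S *m S = S.
  by rewrite Srel; apply: eq_relmx => u v; rewrite {1}/phi (negPf (phit u)).
have sumphi v : \sum_w (v == phi w)%:R = (v != t)%:R + (v == s)%:R :> algC.
  rewrite (bigD1 t) //= {1}/phi eqxx addrC; congr (_ + _).
  have [->|vt] := eqVneq v t.
    by rewrite big1 // => w _; rewrite eq_sym (negPf (phit w)).
  rewrite (bigD1 v) //= {1}/phi (negPf vt) eqxx big1 ?addr0 // =>
    w /andP[wt wv].
  by rewrite /phi (negPf wt) eq_sym (negPf wv).
have LS : L *m S = L.
  rewrite relS; apply: eq_relmx => _ v.
  have := sumphi v; rewrite (bigD1 t) //= {1}/phi eqxx addrC => /addIr <-.
  rewrite (bigD1 t) //= eqxx mul0r add0r; apply: eq_bigr => w ->.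
  by rewrite mul1r.
have LL : L *m L = n1 *: L.
  rewrite relmxM relmxZ; apply: eq_relmx => _ v.
  by rewrite -mulr_suml sumt.
pose B := A *m S.
have BB : B *m B = A *m A *m S.
  by rewrite /B mulmxA -(mulmxA A S A) SA.
have BS : B *m S = B by rewrite /B -mulmxA SS.
have SB : S *m B = B by rewrite /B mulmxA SA.
have BL : B *m L = d%:R *: L.
  rewrite /B -mulmxA SL relmxM relmxZ; apply: eq_relmx => u v.
  by rewrite -mulr_suml -natr_sum -/(outdeg e u) reg.
have BBS : B *m B + B + S = L.
  have := congr1 (mulmx^~ S) (outlier_mx eo).
  rewrite /= !mulmxDl mul1mx -BB -/A -/B => /eqP;
    rewrite eq_sym -subr_eq => /eqP <-.
  rewrite [X in X - _](_ : _ = relmx (fun _ v => (v != t)%:R + (v == s)%:R));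
    last first.
    have -> : const_mx 1 = relmx (fun _ _ : V => 1) by apply/matrixP=> i j;
      rewrite !mxE.
    rewrite relS; apply: eq_relmx => _ v; rewrite -sumphi.
    by apply: eq_bigr => w _; rewrite mul1r.
  rewrite [X in _ - X](_ : _ = relmx (fun _ v => (v == s)%:R)); last first.
    rewrite relmxM; apply: eq_relmx => u v; rewrite sum_eqr_mul /phi.
    by case: (os_t u) => ->; rewrite ?eqxx // (negPf st).
  by apply/matrixP=> i j; rewrite !mxE addrK.
have LB : L *m B = d%:R *: L.
  rewrite -BL -BBS !mulmxDl !mulmxDr SB BS -!mulmxA; done.
pose E := S - n1^-1 *: L.
have SE : S *m E = E by rewrite mulmxBr -scalemxAr SS SL.
have LE : L *m E = 0.
  by rewrite mulmxBr -scalemxAr LS LL scalerA mulVf // scale1r subrr.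
have EE : E *m E = E by rewrite {1}/E mulmxBl -scalemxAl SE LE scaler0 subr0.
have BE : B *m E = E *m B.
  by rewrite mulmxBr mulmxBl -scalemxAr -scalemxAl BS SB BL LB.
have quad : B *m B *m E + B *m E + 1 *: E = 0.
  by rewrite scale1r -[in X in _ + X = _]SE -!mulmxDl BBS LE.
have trL : \tr L = n1 by rewrite mxtrace_relmx.
have trE : \tr E = n1 - 1.
  rewrite raddfB /= mxtraceZ trL mulVf //; congr (_ - _).
  rewrite mxtrace_relmx -sumt; apply: eq_bigr => u _; rewrite /phi.
  by case: (eqVneq u t) => [->|_]; rewrite ?eqxx // eq_sym (negPf st).
have trBE : \tr (B *m E) = - d%:R.
  rewrite mulmxBr raddfB /= BS -scalemxAr BL !mxtraceZ trL mulrCA mulVf //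
    mulr1.
  rewrite /B mxtrace_mulC SA mxtrace_relmx big1 ?sub0r // => u _.
  by rewrite (no_loop eo).
have [|||q [trEq trBEq]] := real_trace_split (c := 1) _ EE BE quad.
- by rewrite mulr1 ltr1n.
- by rewrite trE realB ?realn.
- by rewrite trBE realN realn.
have dq : d = q by apply/eqP; rewrite -(eqr_nat algC) -eqr_opp -trBE trBEq.
have : #|V|.-1%:R = (2 * q + 1)%N%:R :> algC.
  by rewrite natrD natrM -trEq trE subrK.
by move/eqP; rewrite eqr_nat -dq => /eqP; lia.
Qed.

End TwinOutliers.

Section Diregular.
Variables (V : finType) (e : rel V) (o : V -> V) (d : nat).
Hypothesis eo : is_outlier e o.
Hypothesis reg : forall u, outdeg e u = d.

Lemma sum_outdeg_indeg : \sum_v indeg e v = #|V| * d.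
Proof.
rewrite exchange_big /= -sum_nat_const.
by apply: eq_bigr => u _; rewrite -(reg u).
Qed.

Lemma small_indeg s : indeg e s < d -> (forall u, e (o u) s = false) ->
  forall u, (o u == s) + (o (o u) == s) = 1.
Proof.
move=> s_lt os; pose h := d - indeg e s.
have sumh u : \sum_w e u w * (o w == s) = h.
  by have := walk3_count eo u s; rewrite reg os /h; lia.
have count u : (o u == s) + (o (o u) == s) + h * d.+1 = \sum_v (o v == s).
  have : \sum_v walks2 e u v * (o v == s) + (o (o u) == s) = \sum_v (o v == s).
    rewrite -(sum_pred1_mul (o u) (fun v =>
      nat_of_bool (o v == s))) -big_split /=.
    by apply: eq_bigr => v _; rewrite eo; case: (v == o u);
      rewrite ?mul1n ?addn0.
  move <-; rewrite /walks2.
  under eq_bigr do rewrite !mulnDl big_distrl /=.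
  rewrite !big_split /= sumh.
  under eq_bigr do rewrite eq_sym; rewrite sum_pred1_mul exchange_big /=.
  have -> : \sum_w \sum_v e u w * e w v * (o v == s) = d * h.
    rewrite -[d in RHS](reg u) big_distrl /=; apply: eq_bigr => w _.
    by rewrite -(sumh w) big_distrr /=; apply: eq_bigr => v _; rewrite mulnA.
  by lia.
move=> u; have [w /eqP ow] : exists w, o w == s.
  apply/existsP; apply: contraT; rewrite negb_exists => /forallP no.
  have := sumh u; rewrite big1 => [|w _]; last by rewrite (negPf (no w)) muln0.
  by rewrite /h; lia.
have := count u; rewrite -(count w) ow eqxx (negPf (outlier_neq eo s)); lia.
Qed.

Lemma indeg_const : 1 < d -> #|V| = d * d + d + 2 -> forall v, indeg e v = d.
Proof.
move=> d1 cardV v0; apply/eqP; apply: contraT => v0d.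
have w3 := walk3_count eo; have sumd := sum_outdeg_indeg.
have [v' v'd] : exists v, d < indeg e v.
  apply/existsP; apply: contraT; rewrite negb_exists => /forallP le.
  have /leqif_sum[_] : forall v, true -> indeg e v <= d ?= iff (indeg e v == d).
    by move=> v _; apply: leqif_eq; rewrite leqNgt.
  by rewrite sumd sum_nat_const eqxx => /esym/forallP/(_ v0);
    rewrite (negPf v0d).
have [s sd] : exists v, indeg e v < d.
  apply/existsP; apply: contraT; rewrite negb_exists => /forallP le.
  have /leqif_sum[_] : forall v, true -> d <= indeg e v ?= iff (d == indeg e v).
    by move=> v _; apply: leqif_eq; rewrite leqNgt.
  by rewrite sumd sum_nat_const eqxx => /esym/forallP/(_ v0);
    rewrite eq_sym (negPf v0d).
have tov' u : e (o u) v' by have := w3 u v'; rewrite reg; case: (e _ _) => //;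
  lia.
have indep u w : e (o u) (o w) = false.
  apply/negP=> uw; have := no_shortcut eo uw (tov' w).
  by rewrite tov'.
have hit z : indeg e z < d -> exists w, o w == z.
  move=> zd; apply/existsP; apply: contraT; rewrite negb_exists => /forallP no.
  have := w3 v0 z; rewrite reg big1 => [|w _];
    last by rewrite (negPf (no w)) muln0.
  by lia.
have small z : indeg e z < d -> forall u, (o u == z) + (o (o u) == z) = 1.
  by move=> zd; apply: small_indeg => // u; have [w /eqP <-] := hit z zd;
    apply: indep.
have oss : o (o s) = s.
  by have := small s sd s; rewrite (negPf (outlier_neq eo s)); case: eqP.
have im w : o w = s \/ o w = o s.
  have [|ows] := eqVneq (o w) s; first by left.
  right; apply/eqP; apply: contraT => owt.
  have oow : o (o w) = s.
    by have := small s sd w; rewrite (negPf ows); case: eqP.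
  have nsmall z : z != s -> z != o s -> ~ indeg e z < d.
    move=> zs zt /small/(_ s); rewrite oss.
    by rewrite !(eq_sym _ z) (negPf zs) (negPf zt).
  have ow_le u := w3 u (o w).
  have /negP wsm : ~ indeg e w < d.
    apply: nsmall; first by apply: contraNneq owt => ->.
    by apply: contraNneq ows => ->; rewrite oss.
  have [u uw] : exists u, e u w.
    apply/existsP; apply: contraT; rewrite negb_exists => /forallP no.
    move: wsm; rewrite /indeg big1 => [|u _]; last by rewrite (negPf (no u)).
    by rewrite ltnNge -ltnS ltnNge; lia.
  have := ow_le u; rewrite reg indep (bigD1 w) //= uw eqxx.
  by have := nsmall _ ows owt; lia.
have twin v : e s v = e (o s) v.
  have [/existsP[w /eqP <-]|] := boolP [exists w, o w == v].
    by rewrite indep -{1}oss indep.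
  rewrite negb_exists => /forallP no.
  have sum0 u : \sum_w e u w * (o w == v) = 0.
    by rewrite big1 // => w _; rewrite (negPf (no w)) muln0.
  have := w3 s v; have := w3 (o s) v; rewrite !reg !sum0 oss.
  by case: (e s v); case: (e (o s) v) => //; lia.
have := card_twin_outliers eo reg _ twin im;
  rewrite eq_sym (outlier_neq eo) => /(_ isT).
by rewrite cardV; nia.
Qed.

Lemma outlier_autI : 1 < d -> #|V| = d * d + d + 2 -> outlier_aut e o.
Proof.
move=> d1 cardV; have ind := indeg_const d1 cardV.
have fib v : \sum_u (o u == v) = 1.
  have : \sum_u walks2 e u v + \sum_u (o u == v) = #|V|.
    rewrite -big_split -sum1_card; apply: eq_bigr => u _.
    by rewrite eo eq_sym; case: (o u == v).
  rewrite !big_split /= -/(indeg e v) ind exchange_big /=.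
  have -> : \sum_w \sum_u e u w * e w v = d * d.
    rewrite -[X in X * d](ind v) big_distrl /=; apply: eq_bigr => w _.
    by rewrite -big_distrl /= -(ind w) mulnC.
  under eq_bigr do rewrite -[nat_of_bool _]muln1; rewrite sum_pred1_mul.
  by rewrite cardV; lia.
have oinj : injective o.
  move=> x y oxy; apply/eqP; apply: contraT => xy.
  have := fib (o x); rewrite (bigD1 x) //= (bigD1 y) 1?eq_sym //= oxy eqxx.
  by lia.
split=> // u v; have := walk3_count eo u (o v).
rewrite reg ind; under eq_bigr do rewrite (inj_eq oinj) mulnC.
by rewrite sum_pred1_mul; case: (e u v); case: (e _ _) => //; lia.
Qed.

End Diregular.

Lemma outlier_exists (V : finType) (e : rel V) d :
    (forall u v, walks2 e u v <= 1) -> (forall u, outdeg e u = d) ->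
    #|V| = d * d + d + 2 ->
  exists o : V -> V, is_outlier e o.
Proof.
move=> le1 reg cardV.
have sum1 u : \sum_v (walks2 e u v == 0) = 1.
  have : \sum_v walks2 e u v + \sum_v (walks2 e u v == 0) = #|V|.
    rewrite -big_split -sum1_card; apply: eq_bigr => v _ /=.
    by have := le1 u v; case: (walks2 e u v) => [|[|]].
  rewrite sum_walks2 reg; under eq_bigr do rewrite reg.
  by rewrite -big_distrl /= -/(outdeg e u) reg cardV; lia.
pose o u := odflt u [pick v | walks2 e u v == 0]; exists o => u v.
have w0 : walks2 e u (o u) = 0.
  rewrite /o; case: pickP => [w /eqP //|none]; have := sum1 u.
  by rewrite big1 // => w _; rewrite none.
have := sum1 u; rewrite (bigD1 (o u)) //= w0 eqxx => /eqP.
have [-> _|vo] := eqVneq v (o u); first by rewrite w0.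
rewrite (bigD1 v) //=; have := le1 u v.
by case: (walks2 e u v) => [|[|]].
Qed.

Lemma geodetic_walks2 (V : finType) (e : rel V) : geodetic e 2 ->
  forall u v, walks2 e u v <= 1.
Proof.
move=> geo u v; have -> : walks2 e u v =
    (u == v) + e u v + #|[set w | e u w && e w v]|.
  rewrite /walks2 -sum1_card [in RHS]big_mkcond /=; congr (_ + _);
    apply: eq_bigr => w _.
  by rewrite inE; case: (e u w); case: (e w v).
have w0 : u == v -> is_walk e u v [::] by move/eqP.
have w1 : e u v -> is_walk e u v [:: v] by move=> uv; rewrite /is_walk /= uv.
have w2 w : e u w && e w v -> is_walk e u v [:: w; v].
  by case/andP=> uw wv; rewrite /is_walk /= uw wv.
have [le1|/card_gt1P[w [w' []]]] := leqP #|[set w | e u w && e w v]| 1;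
  last first.
  rewrite !inE => /w2 ww /w2 ww' /eqP[].
  by case: (geo _ _ _ _ ww isT ww' isT).
have [->|/card_gt0P[w]] := posnP #|[set w | e u w && e w v]|; last first.
  rewrite inE => /w2 ww.
  have /negPf-> : u != v by apply/negP=> /w0 h;
    have := geo _ _ _ _ ww isT h isT.
  have /negPf-> : ~~ e u v by apply/negP=> /w1 h;
    have := geo _ _ _ _ ww isT h isT.
  by [].
rewrite addn0; case uv: (u == v); last exact: leq_b1.
have /negPf-> // : ~~ e u v.
by apply/negP=> /w1 h; have := geo _ _ _ _ (w0 uv) isT h isT.
Qed.

Theorem theorem8 (V : finType) (e : rel V) : ~ excess_one_digraph 6 2 e.
Proof.
case=> geo [mindeg _]; have -> : moore_bound 6 2 + 1 = 44.
  by rewrite /moore_bound !big_ord_recl big_ord0.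
move=> cardV; have le1 := geodetic_walks2 geo.
have outE u : out_degree e u = outdeg e u.
  rewrite /out_degree -sum1_card big_mkcond; apply: eq_bigr => v _.
  by rewrite inE; case: (e u v).
have reg u : outdeg e u = 6.
  apply/eqP; rewrite eqn_leq -{2}outE mindeg andbT.
  have : \sum_v walks2 e u v <= 44.
    by rewrite -cardV -sum1_card; apply: leq_sum => v _; apply: le1.
  have : outdeg e u * 6 <= \sum_w e u w * outdeg e w.
    by rewrite big_distrl; apply: leq_sum => w _;
      rewrite leq_mul2l -outE mindeg orbT.
  by rewrite sum_walks2; lia.
have [o eo] := outlier_exists le1 reg cardV.
have sys := outlier_autI eo reg isT cardV.
by apply: (no_outlier_aut (leqnn 6) sys) => //; rewrite cardV.
Qed.
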